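(* Every Cantor minimal l.r.s. system $(C,T)$ can be extended to a non-transitive l.r.s. system $(Z,F)$ such that the set of periods of $(Z,F)$ is unbounded. That is, for every minimal l.r.s. system $(C,T)$ on a Cantor set $C$ with metric $d$, there exist a compact metric space $(Z,\rho)$, a continuous surjection $F\colon Z\to Z$ such that $(Z,F)$ is l.r.s. and not transitive, and an isometric embedding $\iota\colon C\to Z$ with $F\circ\iota=\iota\circ T$, such that the set of (least) periods of periodic points of $F$ is unbounded.
   Context: A Cantor set is a (nonempty) $0$-dimensional compact metric space without isolated points. A dynamical system $(X,f)$ consists of a compact metric space $(X,d)$ and a continuous map $f\colon X\to X$. It is minimal if all of its (forward) orbits are dense. It is transitive if for all nonempty open sets $U,V\subset X$ there is $n\ge 1$ with $f^n(U)\cap V\ne\emptyset$. A surjective dynamical system $(X,f)$ is locally radially shrinking (l.r.s.) if for every $x\in X$ there exists $\epsilon_x>0$ such that for all $y\neq x$, $d(x,y)<\epsilon_x$ implies $d(f(x),f(y))<d(x,y)$. *)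

(* Defs.v *)
From HB Require Import structures.
From mathcomp Require Import all_boot all_order all_algebra.
From mathcomp Require Import all_classical all_reals all_analysis.

Set Implicit Arguments.
Unset Strict Implicit.
Unset Printing Implicit Defensive.

Import Order.TTheory GRing.Theory Num.Theory.

Local Open Scope classical_set_scope.
Local Open Scope ring_scope.

(* [zero_dimensional] separates distinct points by clopen sets; in a compact
   metric space this amounts to having a base of clopen sets, see
   [cantor_set_clopen_base]. *)
Definition cantor_set (R : realType) (X : metricType R) : Prop :=
  [/\ [set: X] !=set0, zero_dimensional X, compact [set: X]
    & isolated [set: X] = set0].

Lemma cantor_setP (R : realType) (X : metricType R) :
  cantor_set X <-> [set: X] !=set0 /\ cantor_like X.
Proof.
split=> [[X0 zX cX iX]|[X0 [/perfectP[_ iX] cX _ zX]]]; last by [].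
split=> //; split=> //; last exact: metric_hausdorff.
by apply/perfectP; split=> //; exact: closedT.
Qed.

Lemma cantor_set_clopen_base (R : realType) (X : metricType R) (x : X)
    (U : set X) : cantor_set X -> nbhs x U ->
  exists V : set X, [/\ clopen V, V x & V `<=` U].
Proof.
move=> [_ zX cX _] xU.
have := @zero_dimensional_cvg X x (@metric_hausdorff R X) zX cX.
by move=> /(_ U xU)[V [Vx cV] VU]; exists V.
Qed.

Definition dynamical_system (R : realType) (X : metricType R) (f : X -> X) :
    Prop :=
  compact [set: X] /\ continuous f.

Definition forward_orbit (X : Type) (f : X -> X) (x : X) : set X :=
  range (fun n : nat => iter n f x).

Definition minimal (X : topologicalType) (f : X -> X) : Prop :=
  forall x : X, dense (forward_orbit f x).

Definition topologically_transitive (X : topologicalType) (f : X -> X) :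
    Prop :=
  forall U V : set X, open U -> U !=set0 -> open V -> V !=set0 ->
    exists2 n : nat, (1 <= n)%N & (iter n f @` U) `&` V !=set0.

Definition locally_radially_shrinking (R : realType) (X : metricType R)
    (f : X -> X) : Prop :=
  set_surj [set: X] [set: X] f /\
  forall x : X, exists2 e : R, 0 < e &
    forall y : X, y <> x -> mdist x y < e -> mdist (f x) (f y) < mdist x y.

Definition isometric_embedding (R : realType) (X Y : metricType R)
    (i : X -> Y) : Prop :=
  forall x y : X, mdist (i x) (i y) = mdist x y.

Definition least_period (X : Type) (f : X -> X) (x : X) (n : nat) : Prop :=
  [/\ (0 < n)%N, iter n f x = x
    & forall m : nat, (0 < m < n)%N -> iter m f x <> x].

Definition periods (X : Type) (f : X -> X) : set nat :=
  [set n | exists x : X, least_period f x n].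

Definition unbounded (A : set nat) : Prop :=
  forall N : nat, exists2 n : nat, A n & (N < n)%N.

(* Main.v *)
Require Import Defs.
From HB Require Import structures.
From mathcomp Require Import all_boot all_order all_algebra.
From mathcomp Require Import all_classical all_reals all_analysis.
From mathcomp Require Import lra.

Set Implicit Arguments.
Unset Strict Implicit.
Unset Printing Implicit Defensive.

Import Order.TTheory GRing.Theory Num.Theory.
Import metricType_numDomainType.

Local Open Scope classical_set_scope.
Local Open Scope ring_scope.

(** The idea is to surround [C] by countably many periodic orbits made of
    isolated points, the [k]-th of which follows a segment
    [T x_k, ..., T^(m+1) x_k] of an orbit of [T] and then jumps back to its
    start, and which tend to [C] as [k] grows.  Each new point lies above its
    foot in [C] at a positive height, and a point [x] of [C] is at distance
    [max (d(x, foot), height)] from it.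

    Isolated points shrink trivially, so only the approach of new points to
    points of [C] matters ([locally_radially_shrinking_adjoin]).  As long as an
    orbit follows [T], the shrinking of [T] together with strictly decreasing
    heights suffices.  The problem is the jump back, where the height must go
    up and the foot [y_k = T^(m+1) x_k] is sent to [T x_k] rather than to
    [T y_k].  The trick is to let all the points [y_k] tend to one point [x0],
    with [m] depending on [k].
    A point [x <> x0] of [C] then has only finitely many jumps nearby, which a
    small radius excludes, and so the jumps need to shrink distances to [x0]
    only: the start of the [k]-th orbit must be closer to [T x0] than [y_k] is
    to [x0].  Since [x0] is not isolated, some [x_k <> x0] lies so close to it
    that [d(T x0, T x_k) < d(x0, x_k)]; by minimality [x_k] returns, after an
    arbitrarily long time, so close to itself that the strict inequality
    survives with [x_k] replaced by the returning point [y_k] on the right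
    ([shrinking_return]).  It then suffices that the heights of the orbit stay
    below [d(x0, y_k)].

    The lengths of the segments give unbounded periods, and two distinct
    isolated periodic orbits contradict transitivity. *)

(** * Adjoining isolated points to a metric space *)

(** The space [C] with one extra point [inr i] above [p i] at height [h i], for
    every [i].  The parameters [p] and [h] are phantom: they make the type
    determine its metric. *)
Definition adjoin (R : realType) (C : metricType R) (I : choiceType)
  (p : I -> C) (h : I -> {posnum R}) : Type := (C + I)%type.

Section AdjoinMetric.
Variables (R : realType) (C : metricType R) (I : choiceType).
Variables (p : I -> C) (h : I -> {posnum R}).

HB.instance Definition _ := Choice.copy (adjoin p h) (C + I)%type.

Definition foot (z : adjoin p h) : C :=
  match z with inl x => x | inr i => p i end.

Definition height (z : adjoin p h) : R :=
  match z with inl _ => 0 | inr i => (h i)%:num end.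

Lemma height_ge0 z : 0 <= height z.
Proof. by case: z => //= i. Qed.

(** Two distinct points are at least as far apart as each of them is high: in
    the second component this is the ultrametric on heights, so that new points
    are isolated whatever their feet and heights are. *)
Definition adjoin_dist (a b : adjoin p h) : R :=
  if a == b then 0
  else Num.max (mdist (foot a) (foot b)) (Num.max (height a) (height b)).

Let adjoin_distxx a : adjoin_dist a a = 0.
Proof. by rewrite /adjoin_dist eqxx. Qed.

Let adjoin_dist_positivity a b : adjoin_dist a b = 0 -> a = b.
Proof.
rewrite /adjoin_dist; case: eqVneq => // /eqP ab d0.
have : Num.max (mdist (foot a) (foot b)) (Num.max (height a) (height b)) <= 0.
  by rewrite d0.
rewrite !ge_max => /and3P[].
case: a b ab {d0} => [x|i] [y|j] //= ab; last 3 first.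
- by move=> _ _; rewrite leNgt gt0.
- by move=> _; rewrite leNgt gt0.
- by move=> _; rewrite leNgt gt0.
move=> d0 _ _; congr inl; apply: mdist_positivity; apply/eqP.
by rewrite eq_le d0 mdist_ge0.
Qed.

Let adjoin_dist_sym a b : adjoin_dist a b = adjoin_dist b a.
Proof.
by rewrite /adjoin_dist eq_sym metric_sym [Num.max (height a) _]maxC.
Qed.

Let adjoin_dist_triangle b a c :
  adjoin_dist a c <= adjoin_dist a b + adjoin_dist b c.
Proof.
have [->|ab] := eqVneq a b; first by rewrite adjoin_distxx add0r.
have [->|bc] := eqVneq b c; first by rewrite adjoin_distxx addr0.
have dge x y : 0 <= adjoin_dist x y.
  by rewrite /adjoin_dist; case: ifP => // _; rewrite le_max mdist_ge0.
have [->|ac] := eqVneq a c; first by rewrite adjoin_distxx addr_ge0.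
rewrite /adjoin_dist (negbTE ab) (negbTE bc) (negbTE ac).
have t := metric_triangle (foot a) (foot b) (foot c).
have := mdist_ge0 (foot a) (foot b); have := mdist_ge0 (foot b) (foot c).
have := height_ge0 a; have := height_ge0 b; have := height_ge0 c.
rewrite !ge_max => *; apply/and3P; split.
- by rewrite (le_trans t)// lerD// le_max lexx.
- by rewrite -[leLHS]addr0 lerD// !le_max ?lexx ?orbT//; apply/orP; left.
- by rewrite -[leLHS]add0r lerD// !le_max ?lexx ?orbT//; apply/orP; left.
Qed.

HB.instance Definition _ := isMetric.Build R (adjoin p h)
  adjoin_distxx adjoin_dist_positivity adjoin_dist_sym adjoin_dist_triangle.

Let mdistE (a b : adjoin p h) : mdist a b = adjoin_dist a b.
Proof. by []. Qed.

Lemma mdist_inl (x y : C) :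
  mdist (inl x : adjoin p h) (inl y : adjoin p h) = mdist x y.
Proof.
rewrite mdistE /adjoin_dist; case: eqVneq => [[->]|_ /=].
  by rewrite mdistxx.
by rewrite !max_l// mdist_ge0.
Qed.

Lemma mdist_inl_inr (x : C) (i : I) :
  mdist (inl x : adjoin p h) (inr i : adjoin p h)
  = Num.max (mdist x (p i)) (h i)%:num.
Proof. by rewrite mdistE /adjoin_dist/= (@max_r _ _ 0). Qed.

Lemma mdist_inr_ge (i : I) (z : adjoin p h) :
  z <> inr i -> (h i)%:num <= mdist (inr i : adjoin p h) z.
Proof.
move=> /eqP; rewrite eq_sym => /negbTE zi.
by rewrite mdistE /adjoin_dist zi !le_max lexx orbT.
Qed.

Lemma open_inr (i : I) : open [set (inr i : adjoin p h)].
Proof.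
rewrite openE => z ->; apply/nbhs_ballP; exists (h i)%:num => //= y.
rewrite ballEmdist/= => yi; apply: contrapT => /mdist_inr_ge.
by rewrite leNgt yi.
Qed.

(** An ultrafilter containing some set of points of height at least [e > 0]
    lives on finitely many points.  Otherwise heights tend to [0] along it, and a cluster point of
    its feet in [C] is its limit. *)
Lemma compact_adjoin : compact [set: C] ->
  (forall e : R, 0 < e -> finite_set [set i | e <= (h i)%:num]) ->
  compact [set: adjoin p h].
Proof.
move=> cC fin; rewrite compact_ultra => F FU _.
have [[e e0 Fe]|nF] :=
  pselect (exists2 e : R, 0 < e & F [set z | e <= height z]).
  have cpt : compact [set z : adjoin p h | e <= height z].
    apply: finite_compact; apply: sub_finite_set (finite_image inr (fin e e0)).
    by move=> [x|i] //= ei; [rewrite leNgt e0 in ei|exists i].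
  rewrite compact_ultra in cpt; have [z [_ Fz]] := cpt _ FU Fe.
  by exists z.
have Flow (e : R) : 0 < e -> F [set z | height z < e].
  move=> e0; have [Fe|] := in_ultra_setVsetC [set z | e <= height z] FU.
    by case: nF; exists e.
  by apply: filterS => z /= /negP; rewrite -ltNge.
have [x [_ xF]] := cC (foot @ F) _ filterT.
exists (inl x); split=> //.
suff : cluster F (inl x) by rewrite ultra_cvg_clusterE.
move=> A B FA.
move=> /nbhs_ballP[e /= e0 eB].
have [||] := xF (foot @` (A `&` [set z | height z < e])) (ball x e).
- rewrite /fmap/=; apply: filterS (filterI FA (Flow e e0)).
  exact: preimage_image.
- exact: nbhsx_ballx.
move=> _ [[z [Az ze] <-]]; rewrite ballEmdist/= => xz.
exists z; split=> //; apply: eB; rewrite ballEmdist/=.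
case: z {Az} ze xz => [y|i] /= ze xz; first by rewrite mdist_inl.
by rewrite mdist_inl_inr gt_max xz.
Qed.

Section AdjoinMap.
Variables (T : C -> C) (s : I -> I).

Definition adjoin_map (z : adjoin p h) : adjoin p h :=
  match z with inl x => inl (T x) | inr i => inr (s i) end.

Lemma iter_adjoin_map_inr n i :
  iter n adjoin_map (inr i) = inr (iter n s i).
Proof. by elim: n => //= n ->. Qed.

(** Within radius [h i] of [inr i] there is no other point, so the shrinking has
    to be checked only around points of [C], against new points. *)
Lemma locally_radially_shrinking_adjoin :
  locally_radially_shrinking T -> set_surj [set: I] [set: I] s ->
  (forall x : C, exists2 e : R, 0 < e &
     forall i, mdist x (p i) < e -> (h i)%:num < e ->
     Num.max (mdist (T x) (p (s i))) (h (s i))%:num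
     < Num.max (mdist x (p i)) (h i)%:num) ->
  locally_radially_shrinking adjoin_map.
Proof.
move=> [Tsurj Tshr] ssurj cross; split.
  move=> [x|i] _.
    by have [y _ <-] := Tsurj x Logic.I; exists (inl y).
  by have [j _ <-] := ssurj i Logic.I; exists (inr j).
move=> [x|i]; last first.
  exists (h i)%:num => // y yi; rewrite ltNge.
  by rewrite mdist_inr_ge.
have [e e0 eT] := Tshr x; have [e' e'0 eS] := cross x.
exists (Num.min e e'); first by rewrite lt_min e0.
move=> [y|i] yx; rewrite lt_min => /andP[].
  rewrite /= !mdist_inl => ? _; apply: eT => // yx'; apply: yx.
  by rewrite yx'.
rewrite /= !mdist_inl_inr => _; rewrite gt_max => /andP[? ?]; exact: eS.
Qed.

End AdjoinMap.
End AdjoinMetric.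

(** * Continuity and non-transitivity *)

Lemma locally_radially_shrinking_continuous (R : realType) (X : metricType R)
  (f : X -> X) : locally_radially_shrinking f -> continuous f.
Proof.
move=> [_ fshr] x; apply/cvgrPdist_lt => e e0; have [d d0 fd] := fshr x.
apply/nbhs_ballP; exists (Num.min d e); first by rewrite /= lt_min d0.
move=> y; rewrite ballEmdist/= lt_min => /andP[yd ye].
have [->|yx] := pselect (y = x); first by rewrite mdistxx.
by rewrite (lt_trans _ ye)// fd.
Qed.

Lemma not_transitive_open_points (X : topologicalType) (f : X -> X) (a b : X) :
  open [set a] -> open [set b] -> (forall n, iter n f a <> b) ->
  ~ topologically_transitive f.
Proof.
move=> oa ob nab /(_ _ _ oa (ex_intro _ a erefl) ob (ex_intro _ b erefl)).
by move=> [n _ [_ [[_ -> <-] /nab]]].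
Qed.

(** * A disjoint union of cycles *)

Section Cycles.
Variable m : nat -> nat.

Definition cycles : choiceType := {k : nat & 'I_(m k).+1}.

Definition node k (j : 'I_(m k).+1) : cycles :=
  existT (fun k => 'I_(m k).+1) k j.

Definition next (i : cycles) : cycles := node (ordS (tagged i)).

Lemma next_surj : set_surj [set: cycles] [set: cycles] next.
Proof.
move=> [k j] _; exists (node (ord_pred j)) => //.
by rewrite /next/= ord_predK.
Qed.

Lemma iter_next n k (j : 'I_(m k).+1) :
  iter n next (node j) = node (iter n (@ordS _) j).
Proof. by elim: n => //= n ->. Qed.

Lemma val_iter_ordS n k (j : 'I_k) : (iter n (@ordS k) j = (j + n) %% k :> nat)%N.
Proof.
elim: n => [|n IHn]; first by rewrite addn0 modn_small.
by rewrite iterS/= IHn -addn1 modnDml addn1 addnS.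
Qed.

Lemma least_period_next k :
  least_period next (node (@ord0 (m k))) (m k).+1.
Proof.
split=> //.
  rewrite iter_next; congr node; apply: val_inj.
  by apply: etrans (val_iter_ordS _ _) _; rewrite modnn.
move=> n /andP[n0 nk]; rewrite iter_next => /eqP.
rewrite eq_Tagged => /eqP/(congr1 (@nat_of_ord _)).
by rewrite val_iter_ordS add0n modn_small// => n0'; rewrite n0' in n0.
Qed.

End Cycles.

Arguments node : clear implicits.

(** * Returns of a minimal shrinking system *)

Section Returns.
Variables (R : realType) (C : metricType R) (T : C -> C).

(** Density of the orbit of [T^(N+1) x], rather than of [x], makes the return
    late. *)
Lemma minimal_recurrence (U : set C) (x : C) (N : nat) :
  minimal T -> open U -> U x -> exists2 n, (N <= n)%N & U (iter n.+1 T x).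
Proof.
move=> minT oU Ux.
have [z [Uz [n _ nz]]] := minT (iter N.+1 T x) U (ex_intro _ x Ux) oU.
exists (n + N)%N; first exact: leq_addl.
by rewrite -addnS iterD nz.
Qed.

Lemma open_mdist_gt (x : C) (r : R) : open [set y | r < mdist x y].
Proof.
rewrite openE => y /= ry; apply/nbhs_ballP.
exists (mdist x y - r); first by rewrite /= subr_gt0.
move=> z; rewrite ballEmdist/= => yz.
have := metric_triangle x z y; rewrite (metric_sym z y); lra.
Qed.

Lemma open_mdist_lt (x : C) (r : R) : open [set y | mdist x y < r].
Proof.
rewrite openE => y /= ry; apply/nbhs_ballP.
exists (r - mdist x y); first by rewrite /= subr_gt0.
move=> z; rewrite ballEmdist/= => yz.
have := metric_triangle x y z; lra.
Qed.

(** A pseudo-orbit that starts at [T x] and ends at [T^(m+1) x] can be closed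
    up by a jump that shrinks the distance to [x0].  The inequality holds with
    [x] in place of its return when [x] is near [x0], and it is an open
    condition on the returning point. *)
Lemma shrinking_return (x0 : C) (k : nat) :
  limit_point [set: C] x0 -> minimal T -> locally_radially_shrinking T ->
  exists (x : C) (m : nat), [/\ (k <= m)%N,
    mdist (T x0) (T x) < mdist x0 (iter m.+1 T x)
    & mdist x0 (iter m.+1 T x) < k.+1%:R^-1].
Proof.
move=> lx0 minT [_ Tshr]; have [e e0 eT] := Tshr x0.
have r0 : 0 < Num.min e (k.+1%:R^-1) by rewrite lt_min e0 invr_gt0 ltr0Sn.
have [x [/eqP xx0 _]] := lx0 _ (nbhsx_ballx x0 _ r0).
rewrite ballEmdist/= lt_min => /andP[xe xk].
have Txx0 := eT x xx0 xe.
have [n kn [n1 n2]] := @minimal_recurrence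
  ([set y | mdist (T x0) (T x) < mdist x0 y] `&` [set y | mdist x0 y < k.+1%:R^-1])
  x k minT (openI (open_mdist_gt _ _) (open_mdist_lt _ _)) (conj Txx0 xk).
by exists x, n.
Qed.

End Returns.

Theorem theorem1p5 (R : realType) (C : metricType R) (T : C -> C) :
  cantor_set C ->
  dynamical_system T -> minimal T -> locally_radially_shrinking T ->
  exists (Z : metricType R) (F : Z -> Z) (iota : C -> Z),
    [/\ dynamical_system F,
        locally_radially_shrinking F,
        ~ topologically_transitive F,
        isometric_embedding iota /\ (forall x : C, F (iota x) = iota (T x))
      & unbounded (periods F)].
Proof.
move=> /cantor_setP[[x0 _] [[_ perfC] cC _ _]] _ minT Tlrs.
have {perfC}lx0 : limit_point [set: C] x0 by rewrite perfC.
have /choice[a] := fun k => shrinking_return k lx0 minT Tlrs.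
move=> /choice[m am].
have km k : (k <= m k)%N by case: (am k).
pose y k := iter (m k).+1 T (a k).
have Ty k : mdist (T x0) (T (a k)) < mdist x0 (y k) by case: (am k).
have yk k : mdist x0 (y k) < k.+1%:R^-1 by case: (am k).
have y0 k : 0 < mdist x0 (y k) / 2.
  by rewrite divr_gt0// (le_lt_trans (mdist_ge0 _ _) (Ty k)).
(* The feet start at [T (a k)] so that the node before the jump, of index [m k],
   has foot [y k].  The heights start at [d(x0, y k) / 2], and division by the
   rank makes them decrease along the cycle. *)
pose p (i : cycles m) := iter (tagged i).+1 T (a (tag i)).
have hgt0 (i : cycles m) : 0 < mdist x0 (y (tag i)) / 2 / (tagged i).+1%:R.
  by rewrite divr_gt0.
pose h (i : cycles m) : {posnum R} := PosNum (hgt0 i).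
have h_le i : (h i)%:num <= mdist x0 (y (tag i)) / 2.
  by rewrite /= ler_pdivrMr// ler_peMr ?(ltW (y0 _))// ler1n.
have h_lt i : (h i)%:num < (tag i).+1%:R^-1.
  apply: le_lt_trans (h_le i) (le_lt_trans _ (yk _)).
  by have := y0 (tag i); lra.
have lrsF : locally_radially_shrinking (@adjoin_map _ _ _ p h T (@next m)).
  apply: locally_radially_shrinking_adjoin => //; first exact: next_surj.
  move=> x; have [_ /(_ x)[e e0 eT]] := Tlrs.
  (* Away from [x0] the jumps of large index are far from [x], because [y k]
     tends to [x0], and the finitely many others have positive height. *)
  have [d d0 dclose] : exists2 d : R, 0 < d & forall k, x <> x0 ->
      mdist x (y k) < d -> d <= (h (node m k ord_max))%:num.
    have [->|xx0] := pselect (x = x0); first by exists 1.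
    have D0 : 0 < mdist x x0 / 2 by rewrite divr_gt0// mdist_gt0; exact/eqP.
    have [K _ KD] := near_infty_natSinv_lt (PosNum D0).
    pose hc k := (h (node m k ord_max))%:num.
    exists (\big[Num.min/mdist x x0 / 2]_(k < K) hc k).
      by apply: lt_bigmin => // k _; exact: hgt0.
    move=> k _ xd; have [kK|/KD/= Kk] := ltnP k K.
      exact: (bigmin_le _ (Ordinal kK)).
    have xd' := lt_le_trans xd (bigmin_le_id _ _ _ _).
    have := metric_triangle x (y k) x0; rewrite (metric_sym (y k)).
    by rewrite leNgt [ltRHS]splitr (ltrD xd' (lt_trans (yk k) Kk)).
  exists (Num.min e d); first by rewrite lt_min e0.
  move=> [k j]; rewrite !lt_min => /andP[xe xd] /andP[_ hd].
  have [jm|jm] := ltnP j (m k).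
    (* A step that follows [T]; the decrease of heights is what saves the case
       where the foot is [x] itself. *)
    have nE : tagged (next (node m k j)) = j.+1 :> nat.
      by rewrite /= modn_small.
    have pT : p (next (node m k j)) = T (p (node m k j)).
      by rewrite /p nE.
    have hS : (h (next (node m k j)))%:num < (h (node m k j))%:num.
      rewrite /h/= modn_small// ltr_pM2l ?y0// ltf_pV2 ?posrE ?ltr0Sn//.
      by rewrite ltr_nat.
    rewrite pT gt_max !lt_max hS orbT andbT.
    have [<-|px] := pselect (p (node m k j) = x).
      by rewrite mdistxx hgt0 orbT.
    by rewrite eT.
  (* The node before the jump: [dclose] leaves only the case [x = x0], where
     the choice of [a k] makes the jump shrink. *)
  have {jm}jE : j = ord_max.
    by apply/val_inj/anti_leq; rewrite jm -ltnS ltn_ord.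
  move: xe xd hd; rewrite {}jE => xe xd hd.
  have [xx0|/dclose/(_ xd)] := pselect (x = x0); last by rewrite leNgt hd.
  have nE : next (node m k ord_max) = node m k ord0.
    by congr node; apply: val_inj; rewrite /= modnn.
  rewrite nE xx0 gt_max !lt_max; apply/andP; split; first by rewrite Ty.
  apply/orP; left; apply: le_lt_trans (h_le _) _ => /=.
  by have := y0 k; rewrite -/(y k); lra.
exists (adjoin p h), (@adjoin_map _ _ _ p h T (@next m)), inl; split.
- split; last exact: locally_radially_shrinking_continuous.
  apply: compact_adjoin => // e e0.
  have [K _ Ke] := near_infty_natSinv_lt (PosNum e0).
  pose below := \bigcup_(k in `I_K) (range (fun j : 'I_(m k).+1 => node m k j)).
  apply: (@sub_finite_set _ _ below).
    move=> [k j] /= ej; exists k; last by exists j.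
    rewrite /= ltnNge; apply/negP => /Ke /= ke.
    by have := lt_trans (h_lt (node m k j)) ke; rewrite ltNge ej.
  by apply: bigcup_finite => // k _; apply: finite_image; exact: finite_finset.
- exact: lrsF.
- pose start k := node m k ord0.
  apply: (@not_transitive_open_points (adjoin p h) _
    (inr (start 0%N)) (inr (start 1%N))).
  + exact: open_inr.
  + exact: open_inr.
  + by move=> n; rewrite iter_adjoin_map_inr iter_next => -[].
- by split=> // x x'; rewrite mdist_inl.
- move=> N; exists (m N).+1; last exact: km.
  exists (inr (node m N ord0)).
  have [? per least] := least_period_next m N; split=> //.
    by rewrite iter_adjoin_map_inr per.
  by move=> n /least nper; rewrite iter_adjoin_map_inr => -[].
Qed.
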